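(* Let $L$ be a bounded distributive lattice. Then: (1) for any $\phi\in\mathrm{Con}(L)$, $\phi$ has BLP if and only if $\phi$ has FCLP; (2) $L$ has BLP if and only if $L$ has FCLP.
   Context: For a bounded distributive lattice $L$, $\mathcal{B}(L)$ is the Boolean algebra of complemented elements of $L$. A congruence $\phi$ of $L$ has BLP (Boolean Lifting Property) if the Boolean morphism $\mathcal{B}(L)\to\mathcal{B}(L/\phi)$, $a\mapsto a/\phi$, is surjective; $L$ has BLP if all its congruences have BLP. Lattices are congruence-distributive: $\mathrm{Con}(L)$, the bounded lattice of congruences ordered by inclusion, with bottom $\Delta_L$ (equality), top $\nabla_L=L^2$, meet $\cap$ and join $\vee$ (generated congruence), is distributive. A congruence $\phi$ of $L$ is a factor congruence if there is $\phi^*\in\mathrm{Con}(L)$ with $\phi\vee\phi^*=\nabla_L$, $\phi\cap\phi^*=\Delta_L$ and $\phi\circ\phi^*=\phi^*\circ\phi$ ($\circ$ is relational composition). $\mathrm{FC}(L)$ is the set of factor congruences of $L$; it is a Boolean sublattice of $\mathrm{Con}(L)$. For $\phi\in\mathrm{Con}(L)$, the map $\mathrm{FC}(L)\to\mathrm{FC}(L/\phi)$, $\alpha\mapsto(\alpha\vee\phi)/\phi=\{(a/\phi,b/\phi)\mid(a,b)\in\alpha\vee\phi\}$, is a well-defined Boolean morphism; $\phi$ has FCLP (Factor Congruence Lifting Property) if this map is surjective, and $L$ has FCLP if all its congruences have FCLP. *)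

(* Defs.v *)
From HB Require Import structures.
From mathcomp Require Import all_boot all_order.
From mathcomp Require Import boolp classical_sets functions.

Set Implicit Arguments.
Unset Strict Implicit.
Unset Printing Implicit Defensive.

Import Order.TTheory.
Local Open Scope order_scope.
Local Open Scope classical_set_scope.
Local Open Scope quotient_scope.

Section Congruences.
Context {d : Order.disp_t} {L : latticeType d}.

(* Relations on L are sets of pairs, so that inclusion, intersection, Delta_L
   and nabla_L are `<=`, `&`, diagonal and setT. *)
Definition is_congruence (r : set (L * L)) : Prop :=
  [/\ forall x, r (x, x),
      forall x y, r (x, y) -> r (y, x),
      forall x y z, r (x, y) -> r (y, z) -> r (x, z),
      forall x x' y y',
        r (x, x') -> r (y, y') -> r ((x `&` y)%O, (x' `&` y')%O) &
      forall x x' y y',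
        r (x, x') -> r (y, y') -> r ((x `|` y)%O, (x' `|` y')%O)].

Definition con_join (r s : set (L * L)) : set (L * L) :=
  smallest is_congruence (r `|` s).

End Congruences.

Record congruence {d : Order.disp_t} (L : latticeType d) := Congruence {
  con_set :> set (L * L);
  con_setP : is_congruence con_set
}.

Definition factor_congruence {d : Order.disp_t} (L : latticeType d) :
    set (set (L * L)) :=
  [set r | is_congruence r /\ exists s : set (L * L), is_congruence s /\
    [/\ con_join r s = setT, r `&` s = diagonal & (r \; s = s \; r)%relation]].

Definition complemented {d : Order.disp_t} (L : tbDistrLatticeType d) :
    set L :=
  [set x | exists y : L, (x `&` y)%O = \bot /\ (x `|` y)%O = \top].

Section Quotient.
Context {d : Order.disp_t} {L : tbDistrLatticeType d} (phi : congruence L).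

Definition con_rel : rel L := fun x y => `[< con_set phi (x, y) >].

Lemma con_rel_refl : reflexive con_rel.
Proof. by move=> x; apply/asboolP; case: (con_setP phi). Qed.

Lemma con_rel_sym : symmetric con_rel.
Proof.
have [_ s _ _ _] := con_setP phi.
by move=> x y; apply/asboolP/asboolP; apply: s.
Qed.

Lemma con_rel_trans : transitive con_rel.
Proof.
have [_ _ t _ _] := con_setP phi.
move=> y x z /asboolP xy /asboolP yz; apply/asboolP; exact: t xy yz.
Qed.

Canonical con_equiv := EquivRel con_rel con_rel_refl con_rel_sym con_rel_trans.

Definition quotient := {eq_quot con_equiv}.

HB.instance Definition _ := Choice.on quotient.
HB.instance Definition _ := EqQuotient.on quotient.

Lemma quotientP (x y : L) :
  \pi_quotient x = \pi_quotient y <-> con_set phi (x, y).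
Proof.
split=> [/eqP|xy]; first by rewrite eqmodE => /asboolP.
by apply/eqP; rewrite eqmodE; apply/asboolP.
Qed.

Definition quot_meet := lift_op2 quotient (@Order.meet d L).
Definition quot_join := lift_op2 quotient (@Order.join d L).

Lemma con_repr (x : L) : con_set phi (repr (\pi_quotient x), x).
Proof. by apply/quotientP; rewrite reprK. Qed.

Lemma pi_meet : {morph \pi_quotient : x y / (x `&` y)%O >-> quot_meet x y}.
Proof.
have [_ s _ m _] := con_setP phi.
move=> x y; unlock quot_meet; apply/quotientP/s.
by apply: m; apply: con_repr.
Qed.

Lemma pi_join : {morph \pi_quotient : x y / (x `|` y)%O >-> quot_join x y}.
Proof.
have [_ s _ _ j] := con_setP phi.
move=> x y; unlock quot_join; apply/quotientP/s.
by apply: j; apply: con_repr.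
Qed.

Lemma quotW (P : quotient -> Prop) : (forall x, P (\pi x)) -> forall q, P q.
Proof. by move=> h q; rewrite -[q]reprK. Qed.

Fact quot_meetC : commutative quot_meet.
Proof. by elim/quotW=> x; elim/quotW=> y; rewrite -!pi_meet meetC. Qed.

Fact quot_joinC : commutative quot_join.
Proof. by elim/quotW=> x; elim/quotW=> y; rewrite -!pi_join joinC. Qed.

Fact quot_meetA : associative quot_meet.
Proof.
by elim/quotW=> x; elim/quotW=> y; elim/quotW=> z; rewrite -!pi_meet meetA.
Qed.

Fact quot_joinA : associative quot_join.
Proof.
by elim/quotW=> x; elim/quotW=> y; elim/quotW=> z; rewrite -!pi_join joinA.
Qed.

Fact quot_joinKI (y x : quotient) : quot_meet x (quot_join x y) = x.
Proof.
by elim/quotW: y => y; elim/quotW: x => x; rewrite -pi_join -pi_meet joinKI.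
Qed.

Fact quot_meetKU (y x : quotient) : quot_join x (quot_meet x y) = x.
Proof.
by elim/quotW: y => y; elim/quotW: x => x; rewrite -pi_meet -pi_join meetKU.
Qed.

Fact quot_meetUl : left_distributive quot_meet quot_join.
Proof.
elim/quotW=> x; elim/quotW=> y; elim/quotW=> z.
by rewrite -pi_join -!pi_meet -pi_join meetUl.
Qed.

Fact quot_meetxx : idempotent_op quot_meet.
Proof. by elim/quotW=> x; rewrite -pi_meet meetxx. Qed.

HB.instance Definition _ := Order.isMeetJoinDistrLattice.Build d quotient
  (fun _ _ => erefl) (fun _ _ => erefl) quot_meetC quot_joinC quot_meetA
  quot_joinA quot_joinKI quot_meetKU quot_meetUl quot_meetxx.

Fact quot_le0x (x : quotient) : \pi_quotient \bot <= x.
Proof. by elim/quotW: x => x; apply/eqP; rewrite -pi_meet meet0x. Qed.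

Fact quot_lex1 (x : quotient) : x <= \pi_quotient \top.
Proof. by elim/quotW: x => x; apply/eqP; rewrite -pi_meet meetx1. Qed.

HB.instance Definition _ := Order.hasBottom.Build d quotient quot_le0x.
HB.instance Definition _ := Order.hasTop.Build d quotient quot_lex1.

(* The map alpha |-> (alpha \/ phi) / phi. *)
Definition factor_map (alpha : set (L * L)) : set (quotient * quotient) :=
  [set (\pi_quotient p.1, \pi_quotient p.2) | p in con_join alpha phi].

Definition congruence_BLP : Prop :=
  set_surj (@complemented d L) (@complemented d quotient)
    (fun a => \pi_quotient a).

Definition congruence_FCLP : Prop :=
  set_surj (@factor_congruence d L) (@factor_congruence d quotient)
    factor_map.

End Quotient.

Definition lattice_BLP {d : Order.disp_t} (L : tbDistrLatticeType d) : Prop :=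
  forall phi : congruence L, congruence_BLP phi.

Definition lattice_FCLP {d : Order.disp_t} (L : tbDistrLatticeType d) : Prop :=
  forall phi : congruence L, congruence_FCLP phi.

(* Main.v *)
(** In a bounded distributive lattice the factor congruences are exactly the
    [slice_con a = {(x, y) | x /\ a = y /\ a}] with [a] complemented: for a
    factor congruence [r] with complement [s], the composite [r \; s] is
    everything, so [\bot] and [\top] are linked by [\bot s a r \top], and this
    [a] is the element sought.  Moreover
    [slice_con a \/ phi = {(x, y) | x /\ a phi y /\ a}], so the map
    [alpha |-> (alpha \/ phi) / phi] is [a |-> a / phi] in disguise. *)
Require Import Defs.
From mathcomp Require Import all_boot all_order.
From mathcomp Require Import boolp classical_sets functions.

Import Order.TTheory.
Local Open Scope order_scope.
Local Open Scope classical_set_scope.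

Section Join.
Context {d : Order.disp_t} {L : latticeType d}.
Implicit Types r s : set (L * L).

Lemma con_join_least r s t : is_congruence t -> r `<=` t -> s `<=` t ->
  con_join r s `<=` t.
Proof. by move=> tP rt st; apply: smallest_sub => //; rewrite subUset. Qed.

Lemma con_joinl r s : r `<=` con_join r s.
Proof. by move=> p rp t [_]; apply; left. Qed.

Lemma con_joinr r s : s `<=` con_join r s.
Proof. by move=> p sp t [_]; apply; right. Qed.

Lemma con_join_trans r s x y z :
  con_join r s (x, y) -> con_join r s (y, z) -> con_join r s (x, z).
Proof.
move=> xy yz t tP; have [[_ _ tr _ _] _] := tP.
exact: tr (xy t tP) (yz t tP).
Qed.

(* [(r \; s)%relation (x, y)] unfolds to [exists2 z, s (x, z) & r (z, y)]:
   the right factor is applied first. *)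
Lemma con_comp r s : is_congruence r -> is_congruence s ->
  (r \; s = s \; r)%relation -> is_congruence (r \; s)%relation.
Proof.
move=> [r1 r2 r3 r4 r5] [s1 s2 s3 s4 s5] rs.
have srP x y z : s (x, y) -> r (y, z) -> (r \; s)%relation (x, z).
  by move=> xy yz; exists y.
have rsP x y z : r (x, y) -> s (y, z) -> (r \; s)%relation (x, z).
  by move=> xy yz; rewrite rs; exists y.
split.
- by move=> x; apply: (srP _ x).
- by move=> x y [z /= xz zy]; apply: (rsP _ z); [exact: r2|exact: s2].
- move=> x y z [u /= xu uy] [v /= yv vz].
  have [w /= uw wv] := rsP _ _ _ uy yv.
  by apply: (srP _ w); [exact: s3 xu uw|exact: r3 wv vz].
- move=> x x' y y' [u /= xu ux'] [v /= yv vy'].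
  by apply: srP; [exact: s4 xu yv|exact: r4].
- move=> x x' y y' [u /= xu ux'] [v /= yv vy'].
  by apply: srP; [exact: s5 xu yv|exact: r5].
Qed.

(** Since [r] and [s] permute, their composite is itself a congruence; by reflexivity it contains
    both, hence their join. *)
Lemma con_comp_setT r s : is_congruence r -> is_congruence s ->
  con_join r s = setT -> (r \; s = s \; r)%relation ->
  (r \; s)%relation = setT.
Proof.
move=> rP sP rsT rs; apply/seteqP; split=> // p _.
have: con_join r s p by rewrite rsT.
have [r1 _ _ _ _] := rP; have [s1 _ _ _ _] := sP.
apply: con_join_least; first exact: con_comp.
- by move=> [x y] xy; exists x.
- by move=> [x y] xy; exists y.
Qed.

End Join.

Section Slice.
Context {d : Order.disp_t} {L : tbDistrLatticeType d}.
Implicit Types (a b x y : L) (r : set (L * L)).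

Definition slice_con a : set (L * L) := [set p | p.1 `&` a = p.2 `&` a]%O.

(** The elements that [slice_con a] links to [\top] are those above [a], so [a] is recovered as the
    least of them. *)
Lemma slice_con_inj : injective slice_con.
Proof.
move=> a b ab.
have ba : slice_con b (a, \top)%O by rewrite -ab /slice_con /= meetxx meet1x.
have: slice_con a (b, \top)%O by rewrite ab /slice_con /= meetxx meet1x.
rewrite /slice_con /= !meet1x => <-.
by move: ba; rewrite /slice_con /= !meet1x meetC.
Qed.

(** Inverse image of [r] under meeting with [a], a map that preserves meets and, by distributivity,
    joins. It serves for the diagonal and for [phi]. *)
Lemma is_congruence_preim_meet a r : is_congruence r ->
  is_congruence [set p | r (p.1 `&` a, p.2 `&` a)%O].
Proof.
move=> [r1 r2 r3 r4 r5]; split=> /=.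
- by move=> x.
- by move=> x y /r2.
- by move=> x y z; exact: r3.
- move=> x x' y y' xx' yy'.
  by have := r4 _ _ _ _ xx' yy'; rewrite (meetACA x) (meetACA x') meetxx.
- by move=> x x' y y' xx' yy'; rewrite !meetUl; exact: r5.
Qed.

Lemma slice_conP a : is_congruence (slice_con a).
Proof.
have diagP : is_congruence (diagonal : set (L * L)).
  by split=> [x|x y|x y z|x x' y y'|x x' y y']; rewrite /diagonal /= //;
    congruence.
exact: (is_congruence_preim_meet a diagonal diagP).
Qed.

Lemma slice_con_comp a b : (a `&` b)%O = \bot ->
  (slice_con a \; slice_con b)%relation = setT.
Proof.
move=> ab; apply/seteqP; split=> // -[x y] _.
(* The witness agrees with [x] below [b] and with [y] below [a]; disjointness of [a] and [b] removes
   the other term. *)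
exists ((x `&` b) `|` (y `&` a))%O; rewrite /slice_con /= meetUl -!meetA.
  by rewrite ab meetx0 joinx0 meetxx.
by rewrite (meetC b a) ab meetx0 join0x meetxx.
Qed.

(** A complement [b] of [a] supplies the complementary congruence [slice_con b]: both composites are
    everything, and [x] is determined by its meets with [a] and [b]. *)
Lemma factor_slice_con a : complemented a -> factor_congruence (slice_con a).
Proof.
move=> [b [ab0 ab1]]; split; first exact: slice_conP.
exists (slice_con b); split; first exact: slice_conP.
have abT := slice_con_comp _ _ ab0.
split.
- apply/seteqP; split=> // -[x y] _.
  have [z /= xz zy] : (slice_con a \; slice_con b)%relation (x, y) by rewrite abT.
  by apply: (con_join_trans _ _ _ z); [exact: con_joinr|exact: con_joinl].
- apply/seteqP; split=> [[x y] [] |[x y]]; rewrite /slice_con /diagonal /=.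
    by move=> xa xb; rewrite -[x]meetx1 -[y]meetx1 -ab1 !meetUr xa xb.
  by move=> ->.
- by rewrite abT slice_con_comp // meetC.
Qed.

Lemma factor_congruence_slice r : factor_congruence r ->
  exists2 a, complemented a & r = slice_con a.
Proof.
move=> [rP [s [sP [rsT rsI rs]]]].
have compT := con_comp_setT _ _ rP sP rsT rs.
have eq_rs x y : r (x, y) -> s (x, y) -> x = y.
  by move=> rxy sxy; have : (r `&` s) (x, y) by []; rewrite rsI.
(* Exchanging the roles of [r] and [s] gives [\bot r b s \top]. This [b] is the complement of [a]:
   both equations hold modulo [r] and modulo [s]. *)
have [b /= r0b sb1] : (s \; r)%relation (\bot, \top)%O by rewrite -rs compT.
have [a /= s0a ra1] : (r \; s)%relation (\bot, \top)%O by rewrite compT.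
have [r1 r2 r3 r4 r5] := rP; have [s1 s2 s3 s4 s5] := sP.
exists a.
  exists b; split; apply: eq_rs.
  - by have := r4 _ _ _ _ (r1 a) (r2 _ _ r0b); rewrite meetx0.
  - by have := s4 _ _ _ _ (s2 _ _ s0a) (s1 b); rewrite meet0x.
  - by have := r5 _ _ _ _ ra1 (r1 b); rewrite join1x.
  - by have := s5 _ _ _ _ (s1 a) sb1; rewrite joinx1.
(* Meeting with [a] keeps [x] in its [r]-class and sends it into the [s]-class of [\bot]; if
   [x r y], the two meets are thus related by both congruences, hence equal. *)
have r_meeta x : r (x `&` a, x)%O.
  by have := r4 _ _ _ _ (r1 x) ra1; rewrite meetx1.
have s_meeta x : s (\bot, x `&` a)%O.
  by have := s4 _ _ _ _ (s1 x) s0a; rewrite meetx0.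
apply/seteqP; split=> -[x y]; rewrite /slice_con /= => xy.
  apply: eq_rs; first exact: r4.
  by apply: s3 (s_meeta y); exact: s2.
by apply: r3 (r_meeta y); rewrite -xy; apply: r2.
Qed.

Lemma con_join_slice a (phi : congruence L) :
  con_join (slice_con a) phi = [set p | con_set phi (p.1 `&` a, p.2 `&` a)%O].
Proof.
have [p1 p2 p3 p4 p5] := con_setP phi.
have slice_meet x : slice_con a (x, x `&` a)%O.
  by rewrite /slice_con /= -meetA meetxx.
have slice_meetC x : slice_con a (x `&` a, x)%O.
  by rewrite /slice_con /= -meetA meetxx.
apply/seteqP; split=> [|[x y] /= xy].
  apply: con_join_least => [|[x y] /= ->//|[x y] /= xy]; last exact: p4.
  by apply: is_congruence_preim_meet; split.
(* The chain runs through [x /\ a] and [y /\ a]: the outer links lie in the slice, the middle one in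
   [phi]. *)
apply: (con_join_trans _ _ _ (x `&` a)%O); first exact: con_joinl.
by apply: (con_join_trans _ _ _ (y `&` a)%O); [exact: con_joinr|exact: con_joinl].
Qed.

End Slice.

Lemma factor_map_slice (d : Order.disp_t) (L : tbDistrLatticeType d)
    (phi : congruence L) (a : L) :
  @factor_map d L phi (slice_con a) =
  slice_con (\pi_(quotient phi) a : quotient phi)%qT.
Proof.
have slicePi x y : slice_con (\pi_(quotient phi) a : quotient phi)%qT
    (\pi_(quotient phi) x, \pi_(quotient phi) y)%qT <->
    con_set phi (x `&` a, y `&` a)%O.
  have <- := quotientP phi (x `&` a)%O (y `&` a)%O.
  by rewrite !pi_meet.
rewrite /factor_map con_join_slice; apply/seteqP; split=> [_ [[x y] /= xy <-]|].
  exact/slicePi.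
move=> [u v]; elim/quotW: u => x; elim/quotW: v => y /slicePi xy.
by exists (x, y).
Qed.

Lemma BLP_FCLP (d : Order.disp_t) (L : tbDistrLatticeType d)
    (phi : congruence L) :
  congruence_BLP phi <-> congruence_FCLP phi.
Proof.
split=> lift.
  move=> r /factor_congruence_slice[c /lift[a aP <-] ->].
  by exists (slice_con a); [exact: factor_slice_con|exact: factor_map_slice].
move=> c /factor_slice_con/lift[_ /factor_congruence_slice[a aP ->]].
(* Both sides are now slices in the quotient, so injectivity gives back an equality of elements. *)
by rewrite factor_map_slice => /slice_con_inj <-; exists a.
Qed.

Theorem proposition4p3 (d : Order.disp_t) (L : tbDistrLatticeType d) :
  (forall phi : congruence L, congruence_BLP phi <-> congruence_FCLP phi) /\
  (lattice_BLP L <-> lattice_FCLP L).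
Proof.
split; first exact: BLP_FCLP.
by split=> lift phi; apply/BLP_FCLP.
Qed.
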